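(* Let $P$ and $Q$ be the stationary observable processes generated by exact finite-state generator $\epsilon$-machines $G_P$ and $G_Q$ over the same nonempty finite alphabet $\mathcal X$. Put $$a=L_{\mathrm{tar}}(G_P),\qquad b=L_{\mathrm{tar}}(G_Q),\qquad d=\max\{L_{\mathrm{sep}}(G_P),L_{\mathrm{sep}}(G_Q)\}.$$ If $P_n=Q_n$ for some $n\ge a+b+d+1$, then $G_P\cong G_Q$.
   Context: Words. $\mathcal X$ is a nonempty finite alphabet, $\mathcal X^m$ the words of length $m$, $\mathcal X^*$ all finite words, $\lambda$ the empty word; $X_i^j=(X_i,\dots,X_j)$. Generator. A finite-state generator $\epsilon$-machine over $\mathcal X$ is $G=(\mathcal S,\pi,\delta,\{e_\sigma\}_{\sigma\in\mathcal S})$ where: (1) $\mathcal S$ is a nonempty finite set of states and each $e_\sigma$ is a probability mass function on $\mathcal X$; (2) a pair $(\sigma,x)$ is admissible when $e_\sigma(x)>0$, and a successor $\delta(\sigma,x)\in\mathcal S$ is defined exactly on admissible pairs; (3) the directed graph of positive-probability labeled transitions $\sigma\to\delta(\sigma,x)$ is strongly connected; (4) for $\sigma\neq\tau$ there is a word $w\in\mathcal X^*$ with $p_\sigma(w)\neq p_\tau(w)$, where $p_\sigma(w)=P(X_1^{|w|}=w\mid S_0=\sigma)$ (so $p_\sigma(\lambda)=1$); (5) $\pi$ is the unique probability vector with $\pi T=\pi$, where $T_{\sigma\tau}=\sum_{x:\,e_\sigma(x)>0,\ \delta(\sigma,x)=\tau}e_\sigma(x)$. The dynamics are $P(X_{t+1}=x,S_{t+1}=\delta(\sigma,x)\mid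 S_t=\sigma)=e_\sigma(x)$ for admissible $(\sigma,x)$, and the process generated by $G$ is the observable process $(X_t)_{t\in\mathbb Z}$ of the stationary joint law with $S_0\sim\pi$. The map $\delta$ is extended to words by iteration along admissible paths, $\delta(\sigma,\lambda)=\sigma$. Block laws. For a stationary process $P$, $P_n(w)=P(X_1^n=w)$ for $w\in\mathcal X^n$, $P_0(\lambda)=1$. Synchronization. A positive-probability word $w\in\mathcal X^m$, $m\ge0$, synchronizes to $\sigma$ if $P(S_m=\sigma\mid X_1^m=w)=1$ (conditioning on $\lambda$ is trivial). $G$ is exact if it has a finite positive-probability synchronizing word. Radii. $L_{\mathrm{tar}}(G)=\max_{\sigma\in\mathcal S}\inf\{|w|: w\text{ synchronizes to }\sigma\}$ ($\inf\emptyset=\infty$), and $L_{\mathrm{sep}}(G)=\max_{\sigma\neq\tau}\min\{|v|:p_\sigma(v)\neq p_\tau(v)\}$. For a one-state generator both radii are set to $0$. Isomorphism. $G\cong G'$ if there is a bijection $f:\mathcal S\to\mathcal S'$ with $\pi'(f(\sigma))=\pi(\sigma)$, $e'_{f(\sigma)}(x)=e_\sigma(x)$ and $\delta'(f(\sigma),x)=f(\delta(\sigma,x))$ for every admissible $(\sigma,x)$. *)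

(* Defs.v *)
From HB Require Import structures.
From mathcomp Require Import all_boot all_order all_algebra.
From mathcomp Require Import all_classical all_reals all_analysis.

Set Implicit Arguments.
Unset Strict Implicit.
Unset Printing Implicit Defensive.

Import Order.TTheory GRing.Theory Num.Theory.

Local Open Scope classical_set_scope.
Local Open Scope ring_scope.

Section Dynamics.
Variables (R : realType) (X S : finType).
Variables (emit : S -> X -> R) (succ : S -> X -> option S).

(* P(X_{t+1} = x, S_{t+1} = t' | S_t = s) *)
Definition step (s : S) (x : X) (t : S) : R :=
  if succ s x == Some t then emit s x else 0.

(* P(X_1^m = w, S_m = t | S_0 = s), by the Markov property *)
Fixpoint run (s : S) (w : seq X) (t : S) : R :=
  if w is x :: w' then \sum_(u : S) step s x u * run u w' t
  else (s == t)%:R.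

(* P(X_1^m = w | S_0 = s), written p_s(w) *)
Definition word_prob (s : S) (w : seq X) : R := \sum_(t : S) run s w t.

Definition transition (s t : S) : R :=
  \sum_(x : X | (0 < emit s x) && (succ s x == Some t)) emit s x.

Definition stationary_distribution (mu : S -> R) : Prop :=
  [/\ forall s, 0 <= mu s,
      \sum_(s : S) mu s = 1
    & forall t, \sum_(s : S) mu s * transition s t = mu t].

End Dynamics.

(* The partial map delta is [succ]: [succ s x = None] means undefined. *)
Record generator (R : realType) (X : finType) := Generator {
  state :> finType;
  stat : state -> R;
  succ : state -> X -> option state;
  emit : state -> X -> R;
  state_nonempty : (0 < #|state|)%N;
  emit_ge0 : forall s x, 0 <= emit s x;
  emit_sum1 : forall s, \sum_(x : X) emit s x = 1;
  succ_admissible : forall s x, isSome (succ s x) = (0 < emit s x);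
  strongly_connected : forall s t : state,
    connect [rel u v : state |
      [exists x : X, (0 < emit u x) && (succ u x == Some v)]] s t;
  states_distinct : forall s t : state, s <> t ->
    exists w : seq X, word_prob emit succ s w <> word_prob emit succ t w;
  stat_stationary : stationary_distribution emit succ stat;
  stat_unique : forall mu : state -> R,
    stationary_distribution emit succ mu -> forall s, mu s = stat s
}.

Section Generator.
Variables (R : realType) (X : finType) (G : generator R X).

Definition cond_word_prob (s : G) (w : seq X) : R :=
  word_prob (@emit _ _ G) (@succ _ _ G) s w.

(* P(X_1^m = w, S_m = t) for S_0 ~ stat *)
Definition joint_prob (w : seq X) (t : G) : R :=
  \sum_(s : G) stat s * run (@emit _ _ G) (@succ _ _ G) s w t.

Definition obs_prob (w : seq X) : R := \sum_(t : G) joint_prob w t.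

Definition synchronizes (w : seq X) (s : G) : Prop :=
  0 < obs_prob w /\ joint_prob w s / obs_prob w = 1.

Definition exact : Prop := exists (w : seq X) (s : G), synchronizes w s.

(* Radii live in the extended reals; the infimum of the empty set is +oo.
   For a one-state generator both are 0: the empty word synchronizes, and the
   maximum defining [L_sep] is over no pair at all. *)
Definition L_tar : \bar R :=
  \big[maxe/0%E]_(s : G)
    ereal_inf [set ((size w)%:R)%:E | w in [set w | synchronizes w s]].

Definition L_sep : \bar R :=
  \big[maxe/0%E]_(p : G * G | p.1 != p.2)
    ereal_inf [set ((size v)%:R)%:E | v in
      [set v | cond_word_prob p.1 v <> cond_word_prob p.2 v]].

(* The stationary joint law of the bi-infinite process: every window
   S_t, X_{t+1}, S_{t+1}, ..., X_{t+n}, S_{t+n} has the law of the chain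
   started from [stat], whatever t is. Only the first values of the sequences
   [s] and [x] are relevant. *)
Definition generates d (Omega : measurableType d) (Pr : probability Omega R)
    (St : int -> Omega -> G) (Xt : int -> Omega -> X) : Prop :=
  [/\ forall t s, measurable (St t @^-1` [set s]),
      forall t x, measurable (Xt t @^-1` [set x])
    & forall (t : int) (n : nat) (s : nat -> G) (x : nat -> X),
      Pr [set om | (forall i, (i <= n)%N -> St (t + i%:Z) om = s i) /\
                   (forall i, (0 < i <= n)%N -> Xt (t + i%:Z) om = x i)] =
      (stat (s 0%N) *
       \prod_(0 <= i < n)
          step (@emit _ _ G) (@succ _ _ G) (s i) (x i.+1) (s i.+1))%:E].

End Generator.

(* P(X_1^n = w) *)
Definition block_law (R : realType) (X : finType) d (Omega : measurableType d)
    (Pr : probability Omega R) (Xt : int -> Omega -> X) (n : nat)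
    (w : n.-tuple X) : \bar R :=
  Pr [set om | forall i : 'I_n, Xt (i.+1)%:Z om = tnth w i].

Definition isomorphic (R : realType) (X : finType) (G H : generator R X) :
    Prop :=
  exists f : G -> H,
    [/\ bijective f,
        forall s, stat (f s) = stat s
      & forall s x, 0 < emit s x ->
          emit (f s) x = emit s x /\ succ (f s) x = omap f (succ s x)].

(* Main.v *)
(** A word [w] synchronizing [G_P] to [s] has positive probability under [Q],
    so it can be emitted from some state [r] of [G_Q]; prepending a word that
    synchronizes [G_Q] to [r] gives a word [z] of length at most [a + b] that
    synchronizes [G_P] to [s] and [G_Q] to some [t]. For [|v| <= d + 1] the
    conditional laws [p_s(v) = P(zv)/P(z)] and [q_t(v) = Q(zv)/Q(z)] coincide.
    Length [d] already determines a state, so this matches the states of the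
    two machines bijectively; the remaining letter makes the matching respect
    emissions and successors, and uniqueness of the stationary vector then
    makes it respect [stat]. *)

Require Import Defs.
From mathcomp Require Import all_boot all_order all_algebra.
From mathcomp Require Import all_classical all_reals all_analysis.

Set Implicit Arguments.
Unset Strict Implicit.
Unset Printing Implicit Defensive.

Import Order.TTheory GRing.Theory Num.Theory.

Local Open Scope ring_scope.

(** * Word probabilities and synchronizing words of one generator *)

Section WordProbabilities.
Context {R : realType} {X : finType} {G : generator R X}.
Implicit Types (s t u : G) (x : X) (v w z : seq X).

Local Notation step := (step (@emit R X G) (@succ R X G)).
Local Notation run := (run (@emit R X G) (@succ R X G)).
Local Notation transition := (transition (@emit R X G) (@succ R X G)).

Lemma step_ge0 s x t : 0 <= step s x t.
Proof. by rewrite /Defs.step; case: ifP => // _; apply: emit_ge0. Qed.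

Lemma emit_eq0 s x : succ s x = None -> emit s x = 0.
Proof.
move=> sx; have := succ_admissible s x; rewrite sx /= => /esym/negbT.
by rewrite -leNgt => le0; apply/eqP; rewrite eq_le le0 emit_ge0.
Qed.

Lemma step_sum (F : G -> R) s x u :
  succ s x = Some u -> \sum_t step s x t * F t = emit s x * F u.
Proof.
move=> sx; rewrite (bigD1 u) //= {1}/Defs.step sx eqxx big1 ?addr0 // => t tu.
by rewrite /Defs.step sx (inj_eq Some_inj) eq_sym (negbTE tu) mul0r.
Qed.

Lemma step_sum1 s x : \sum_t step s x t = emit s x.
Proof.
case sx: (succ s x) => [u|].
  have := step_sum (fun=> 1) sx; rewrite mulr1 => <-.
  by apply: eq_bigr => t _; rewrite mulr1.
by rewrite emit_eq0 // big1 // => t _; rewrite /Defs.step sx.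
Qed.

Lemma transitionE s t : transition s t = \sum_x step s x t.
Proof.
rewrite /Defs.transition big_mkcond; apply: eq_bigr => x _.
rewrite /Defs.step; case: eqP => [sx|]; rewrite ?andbF // andbT.
by rewrite -succ_admissible sx.
Qed.

Lemma run_ge0 s w t : 0 <= run s w t.
Proof.
elim: w s => [|x w IH] s /=; first exact: ler0n.
by apply: sumr_ge0 => u _; rewrite mulr_ge0 ?step_ge0.
Qed.

Lemma run_cat s v w t : run s (v ++ w) t = \sum_u run s v u * run u w t.
Proof.
elim: v s => [|x v IH] s /=.
  rewrite (bigD1 s) //= eqxx mul1r big1 ?addr0 // => u us.
  by rewrite eq_sym (negbTE us) mul0r.
under eq_bigr do rewrite IH mulr_sumr.
rewrite exchange_big; apply: eq_bigr => u _ /=.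
by rewrite mulr_suml; apply: eq_bigr => r _; rewrite mulrA.
Qed.

(** Since [succ] is a partial function, the initial state and the word determine the final state; if
    [succ] is undefined along the word, [run] vanishes everywhere and any witness serves. *)
Lemma run_support s w : exists t, forall u, u != t -> run s w u = 0.
Proof.
elim: w s => [|x w IH] s /=.
  by exists s => u us; rewrite eq_sym (negbTE us).
case sx: (succ s x) => [r|].
  by have [t ht] := IH r; exists t => u ut; rewrite (step_sum _ sx) ht ?mulr0.
by exists s => u _; rewrite big1 // => r _; rewrite /Defs.step sx mul0r.
Qed.

Lemma cond_word_prob_ge0 s w : 0 <= cond_word_prob s w.
Proof. by apply: sumr_ge0 => t _; apply: run_ge0. Qed.

Lemma cond_word_prob_cons s x w :
  cond_word_prob s (x :: w) = \sum_u step s x u * cond_word_prob u w.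
Proof.
rewrite /cond_word_prob /word_prob /= exchange_big.
by apply: eq_bigr => u _; rewrite mulr_sumr.
Qed.

Lemma cond_word_prob_succ s x u w : succ s x = Some u ->
  cond_word_prob s (x :: w) = emit s x * cond_word_prob u w.
Proof. by move=> sx; rewrite cond_word_prob_cons (step_sum _ sx). Qed.

Lemma cond_word_prob_nil s : cond_word_prob s [::] = 1.
Proof.
rewrite /cond_word_prob /word_prob /= (bigD1 s) //= eqxx big1 ?addr0 // => t.
by rewrite eq_sym => /negbTE ->.
Qed.

Lemma cond_word_prob1 s x : cond_word_prob s [:: x] = emit s x.
Proof.
rewrite cond_word_prob_cons -step_sum1.
by apply: eq_bigr => u _; rewrite cond_word_prob_nil mulr1.
Qed.

Lemma stat_ge0 s : 0 <= stat s.
Proof. by case: (stat_stationary G). Qed.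

Lemma joint_prob_ge0 w t : 0 <= joint_prob w t.
Proof. by apply: sumr_ge0 => s _; rewrite mulr_ge0 ?stat_ge0 ?run_ge0. Qed.

Lemma joint_prob_nil t : joint_prob [::] t = stat t.
Proof.
rewrite /joint_prob /= (bigD1 t) //= eqxx mulr1 big1 ?addr0 // => s.
by move=> /negbTE ->; rewrite mulr0.
Qed.

Lemma joint_prob_cat v w t :
  joint_prob (v ++ w) t = \sum_u joint_prob v u * run u w t.
Proof.
rewrite /joint_prob; under eq_bigr do rewrite run_cat mulr_sumr.
rewrite exchange_big; apply: eq_bigr => u _ /=.
by rewrite mulr_suml; apply: eq_bigr => s _; rewrite mulrA.
Qed.

Lemma joint_prob_rcons w x t :
  joint_prob (rcons w x) t = \sum_u joint_prob w u * step u x t.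
Proof.
rewrite -cats1 joint_prob_cat; apply: eq_bigr => u _ /=; congr (_ * _).
rewrite (bigD1 t) //= eqxx mulr1 big1 ?addr0 // => s /negbTE ->.
by rewrite mulr0.
Qed.

(** Forgetting the emitted letter only enlarges a probability, and [stat] is invariant under
    [transition]. In particular a state of zero stationary mass stays unreachable after every
    word. *)
Lemma joint_prob_le_stat w t : joint_prob w t <= stat t.
Proof.
elim/last_ind: w t => [|w x IH] t; first by rewrite joint_prob_nil.
have [_ _ <-] := stat_stationary G.
rewrite joint_prob_rcons; apply: ler_sum => s _; apply: ler_pM => //.
- exact: joint_prob_ge0.
- exact: step_ge0.
- rewrite transitionE (bigD1 x) //= lerDl.
  by apply: sumr_ge0 => y _; apply: step_ge0.
Qed.

Lemma obs_prob_cat v w :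
  obs_prob G (v ++ w) = \sum_(s : G) joint_prob v s * cond_word_prob s w.
Proof.
rewrite /obs_prob; under eq_bigr do rewrite joint_prob_cat.
by rewrite exchange_big; apply: eq_bigr => u _; rewrite mulr_sumr.
Qed.

Lemma obs_probE w :
  obs_prob G w = \sum_(s : G) stat s * cond_word_prob s w.
Proof.
by rewrite -(cat0s w) obs_prob_cat; apply: eq_bigr => s _; rewrite joint_prob_nil.
Qed.

Lemma obs_prob_marginal w :
  obs_prob G w = \sum_x obs_prob G (rcons w x).
Proof.
under [RHS]eq_bigr do rewrite -cats1 obs_prob_cat.
rewrite exchange_big; apply: eq_bigr => s _ /=.
rewrite -mulr_sumr; under eq_bigr do rewrite cond_word_prob1.
by rewrite emit_sum1 mulr1.
Qed.

(** The joint probabilities are nonnegative and sum to [obs_prob G w], so one of them exhausts the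
    sum exactly when the others vanish. This form, free of division, suits concatenation. *)
Lemma synchronizesP w s :
  synchronizes w s <->
  0 < obs_prob G w /\ forall t, t != s -> joint_prob w t = 0.
Proof.
split=> -[w0 ws]; split=> //.
  have ws' : joint_prob w s = obs_prob G w.
    by rewrite -[LHS](divfK (lt0r_neq0 w0)) ws mul1r.
  move: ws'; rewrite /obs_prob (bigD1 s) //= => /eqP.
  rewrite -subr_eq0 opprD addrA subrr add0r oppr_eq0 => /eqP sum0 t ts.
  apply: (psumr_eq0P (P := fun t => t != s) _ sum0) => // u _.
  exact: joint_prob_ge0.
have -> : joint_prob w s = obs_prob G w.
  by rewrite /obs_prob (bigD1 s) //= big1 ?addr0 // => t /ws.
by rewrite divff ?lt0r_neq0.
Qed.

(** After a synchronizing word, the law of the future started at [s] is a quotient of observable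
    probabilities; this is how block laws reveal states. *)
Lemma obs_prob_sync w s v : synchronizes w s ->
  obs_prob G (w ++ v) = obs_prob G w * cond_word_prob s v.
Proof.
move=> /synchronizesP[_ w0]; rewrite obs_prob_cat (bigD1 s) //= big1 ?addr0.
  by rewrite /obs_prob [in RHS](bigD1 s) //= big1 ?addr0 // => t /w0.
by move=> t /w0 ->; rewrite mul0r.
Qed.

(* Every state reached after [z] already carries stationary mass, so
   lengthening the past cannot enlarge the support of the final state. *)
Lemma synchronizes_catl z w s :
  synchronizes w s -> 0 < obs_prob G (z ++ w) ->
  synchronizes (z ++ w) s.
Proof.
move=> /synchronizesP[_ w0] zw0; apply/synchronizesP; split=> // t /w0 wt.
rewrite joint_prob_cat big1 // => u _.
have : stat u * run u w t = 0.
  apply: (psumr_eq0P (P := xpredT) _ wt) => // s' _.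
  by rewrite mulr_ge0 ?stat_ge0 ?run_ge0.
move=> /eqP; rewrite mulf_eq0 => /orP[/eqP u0|/eqP ->]; last by rewrite mulr0.
have := joint_prob_le_stat z u; rewrite u0 => zu.
have /eqP -> : joint_prob z u == 0 by rewrite eq_le zu joint_prob_ge0.
by rewrite mul0r.
Qed.

Lemma synchronizes_catr z w s :
  synchronizes z s -> 0 < obs_prob G (z ++ w) ->
  exists t, synchronizes (z ++ w) t.
Proof.
move=> /synchronizesP[_ z0] zw0; have [t ht] := run_support s w.
exists t; apply/synchronizesP; split=> // u /ht su.
rewrite joint_prob_cat big1 // => r _.
by have [->|/z0 ->] := eqVneq r s; rewrite ?su ?mulr0 ?mul0r.
Qed.

End WordProbabilities.

(** * Block laws of the process as finite sums over states *)

Section BlockLaw.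
Local Open Scope classical_set_scope.
Context {R : realType} {X : finType} {d : measure_display}
  {Omega : measurableType d} {Pr : probability Omega R}.

Lemma total_probability (S : finType) (Z : Omega -> S) (A : set Omega) :
  (forall s, measurable (Z @^-1` [set s])) -> measurable A ->
  Pr A = (\sum_(s : S) Pr (A `&` Z @^-1` [set s]))%E.
Proof.
move=> mZ mA.
have -> : (\sum_(s : S) Pr (A `&` Z @^-1` [set s]) =
           \sum_(s \in [set` enum S]) Pr (A `&` Z @^-1` [set s]))%E.
  by rewrite -fsbig_seq ?enum_uniq // big_enum.
rewrite -measure_fin_bigcup //=.
- congr (Pr _); apply/seteqP; split=> [om Aom|om [s _ []]//].
  by exists (Z om) => //=; rewrite mem_enum.
- by move=> s t _ _ [om [[_ /= <-] [_ /= <-]]].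
- by move=> s _; apply: measurableI.
Qed.

Context {G : generator R X} {St : int -> Omega -> G} {Xt : int -> Omega -> X}.
Hypothesis gen : generates Pr St Xt.

(** States are prescribed only from time [m] on: [m = 0] gives the window of [generates], and
    [m = n.+1] leaves every state free. *)
Local Notation event m n s x :=
  [set om | (forall i : nat, (m <= i <= n)%N -> St i%:Z om = s i) /\
            (forall i : nat, (0 < i <= n)%N -> Xt i%:Z om = x i)].

Lemma measurable_event m n (s : nat -> G) (x : nat -> X) :
  measurable (event m n s x).
Proof.
have [mS mX _] := gen.
have -> : event m n s x =
    (\bigcap_(i in [set i | (m <= i <= n)%N]) (St i%:Z @^-1` [set s i])) `&`
    (\bigcap_(i in [set i | (0 < i <= n)%N]) (Xt i%:Z @^-1` [set x i])).
  by apply/seteqP; split=> om.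
by apply: measurableI; rewrite bigcap_mkcond;
   apply: bigcapT_measurable => i; case: ifP.
Qed.

(* The induction on [m] sums out the states one at a time, from time 0 on. *)
Lemma prob_event m n (s : nat -> G) (x : nat -> X) : (m <= n)%N ->
  Pr (event m n s x) =
  (joint_prob (mkseq (fun i => x i.+1) m) (s m) *
   \prod_(m <= i < n)
     step (@emit R X G) (@succ R X G) (s i) (x i.+1) (s i.+1))%:E.
Proof.
have [mS mX window] := gen.
elim: m s => [|m IH] s mn.
  by rewrite joint_prob_nil -(window 0).
rewrite (total_probability (mS m) (measurable_event _ _ _ _)).
pose s' u i := if i == m then u else s i.
transitivity (\sum_u Pr (event m n (s' u) x))%E.
  apply: eq_bigr => u _; congr (Pr _); apply/seteqP; split=> om /=.
    move=> [[Som Xom] Sm]; split=> // i /andP[mi ni]; rewrite /s'.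
    by case: eqVneq => [->//|im]; apply: Som; rewrite ltn_neqAle eq_sym im mi.
  move=> [Som Xom]; split; [split=> //|].
    move=> i /andP[mi ni]; rewrite (Som i); last by rewrite ltnW.
    by rewrite /s' gtn_eqF.
  by have := Som m; rewrite leqnn (ltnW mn) /s' eqxx => /(_ isT).
rewrite (eq_bigr _ (fun u _ => IH (s' u) (ltnW mn))).
rewrite sumEFin; congr (_%:E); rewrite mkseqS joint_prob_rcons mulr_suml.
apply: eq_bigr => u _.
rewrite big_ltn // {1 2}/s' eqxx mulrA {1}/s' gtn_eqF // -!mulrA.
congr (_ * (_ * _)); apply: eq_big_nat => i /andP[mi _].
by rewrite /s' gtn_eqF // gtn_eqF // ltnW.
Qed.

Lemma block_lawE n (w : n.-tuple X) :
  block_law Pr Xt w = (obs_prob G w)%:E.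
Proof.
have [mS _ _] := gen.
have [s0 _] : exists s : G, true.
  by have /card_gt0P[s _] := state_nonempty G; exists s.
(* The empty block is treated apart, as it offers no letter to serve as the default [thead w]. *)
case: n w => [|n] w.
  rewrite tuple0 /block_law (_ : [set om | _] = setT); last first.
    by apply/seteqP; split=> om //= _ [].
  rewrite probability_setT obs_probE; congr (_%:E); apply/esym.
  have [_ <- _] := stat_stationary G.
  by apply: eq_bigr => s _; rewrite cond_word_prob_nil mulr1.
pose x i := nth (thead w) w i.-1.
have wE : mkseq (fun i => x i.+1) n.+1 = w.
  by have := mkseq_nth (thead w) w; rewrite size_tuple.
(* The range of prescribed states is empty, so [s0] is arbitrary; splitting on the last state then
   brings in [prob_event] with an empty product of steps. *)
transitivity (Pr (event n.+2 n.+1 (fun=> s0) x)).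
  congr (Pr _); apply/seteqP; split=> om /=.
    move=> Xom; split=> [i /andP[h1 h2]|[//|i] /= ni].
      by have := leq_trans h1 h2; rewrite ltnn.
    by rewrite (Xom (Ordinal ni)) (tnth_nth (thead w)).
  by move=> [_ Xom] i; rewrite Xom ?ltn_ord // (tnth_nth (thead w)).
rewrite (total_probability (mS n.+1) (measurable_event _ _ _ _)).
rewrite /obs_prob -sumEFin; apply: eq_bigr => u _.
transitivity (Pr (event n.+1 n.+1 (fun=> u) x)).
  congr (Pr _); apply/seteqP; split=> om /=.
    move=> [[_ Xom] Su]; split=> // i; rewrite -eqn_leq => /eqP <- //.
  move=> [Som Xom]; split; [split=> //|by apply: Som; rewrite leqnn].
  move=> i /andP[h1 h2]; by have := leq_trans h1 h2; rewrite ltnn.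
by rewrite prob_event // big_geq // mulr1 wE.
Qed.

End BlockLaw.

(** * Matching the states of two generators *)

Section Matching.
Context {R : realType} {X : finType}.
Implicit Types G H : generator R X.

Definition agree {G H} (k : nat) (s : G) (t : H) : Prop :=
  forall v : seq X, (size v <= k)%N -> cond_word_prob s v = cond_word_prob t v.

(** Together with [sep_bound], the natural-number form of [L_tar G <= a] and [L_sep G <= k]. *)
Definition sync_bound G (a : nat) : Prop :=
  forall s : G, exists2 w, synchronizes w s & (size w <= a)%N.

Definition sep_bound G (k : nat) : Prop :=
  forall s t : G, agree k s t -> s = t.

Lemma obs_prob_shorter {G H} (n : nat) :
  (forall w, size w = n -> obs_prob G w = obs_prob H w) ->
  forall w, (size w <= n)%N -> obs_prob G w = obs_prob H w.
Proof.
(* Induction on the number [k] of missing letters, each of which is summed out at the end of the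
   word. *)
move=> eqn w wn; rewrite -(subnKC wn) in eqn; move: (n - size w)%N eqn => k.
elim: k w {wn} => [|k IH] w eqw; first by apply: eqw; rewrite addn0.
rewrite (obs_prob_marginal (G := G)) (obs_prob_marginal (G := H)).
by apply: eq_bigr => x _; apply: IH => v; rewrite size_rcons addSnnS => /eqw.
Qed.

(* If [w] synchronizes [G] to [s], prepending a word that synchronizes [H] to
   a state from which [w] can be emitted gives a word synchronizing both. *)
Lemma agree_exists {G H} (a b k : nat) :
  sync_bound G a -> sync_bound H b ->
  (forall w, (size w <= a + b + k)%N ->
     obs_prob G w = obs_prob H w) ->
  forall s : G, exists t : H, agree k s t.
Proof.
move=> syncG syncH eqGH s; have [w ws wa] := syncG s.
have w0 : 0 < obs_prob H w.
  by rewrite -eqGH; [case: ws|rewrite -addnA (leq_trans wa) ?leq_addr].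
have [r rw] : exists r : H, 0 < cond_word_prob r w.
  move: w0; rewrite obs_probE => /lt0r_neq0/eqP.
  move=> /(psumr_neq0P (P := xpredT))[i _|r /= r0].
    by rewrite mulr_ge0 ?stat_ge0 ?cond_word_prob_ge0.
  exists r; rewrite lt_def cond_word_prob_ge0 andbT.
  by apply: contraTneq r0 => ->; rewrite mulr0 ltxx.
have [z zr zb] := syncH r.
have zwH : 0 < obs_prob H (z ++ w).
  by rewrite (obs_prob_sync _ zr) mulr_gt0 //; case: zr.
have szw : (size (z ++ w) <= a + b)%N by rewrite size_cat addnC leq_add.
have eqzw : obs_prob G (z ++ w) = obs_prob H (z ++ w).
  by rewrite eqGH // (leq_trans szw) ?leq_addr.
have [t zwt] := synchronizes_catr zr zwH.
have zws : synchronizes (z ++ w) s.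
  by apply: synchronizes_catl => //; rewrite eqzw.
(* Multiplying by the common probability of [z ++ w] turns both sides into probabilities of
   [z ++ w ++ v], whose length is within the bound. *)
exists t => v vk; apply: (mulfI (lt0r_neq0 zwH)).
rewrite -{1}eqzw -(obs_prob_sync _ zws) -(obs_prob_sync _ zwt).
by apply: eqGH; rewrite size_cat leq_add.
Qed.

Lemma agree_isomorphic {G H} (k : nat) :
  sep_bound G k -> sep_bound H k ->
  (forall s : G, exists t : H, agree k.+1 s t) ->
  (forall t : H, exists s : G, agree k.+1 t s) ->
  isomorphic G H.
Proof.
move=> sepG sepH /boolp.choice[f fE] /boolp.choice[g gE].
have fK : cancel f g.
  move=> s; apply: sepG => v vk.
  by rewrite -gE ?fE // ltnW.
have gK : cancel g f.
  move=> t; apply: sepH => v vk.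
  by rewrite -fE ?gE // ltnW.
have f_emit s x : emit (f s) x = emit s x.
  by rewrite -!cond_word_prob1 fE.
have f_succ s x : succ (f s) x = omap f (succ s x).
  (* Equal emissions make both successors defined or both undefined. *)
  have := succ_admissible (f s) x; rewrite f_emit -succ_admissible.
  case fsx: (succ (f s) x) => [t|]; case sx: (succ s x) => [r|] //= _.
  have e0 : emit s x != 0.
    by rewrite lt0r_neq0 // -succ_admissible sx.
  (* Words of length at most [k] separate [t] from [f r]; prefixing [x] uses the one spare letter of
     [k.+1] and moves the comparison back to [f s] and [s]. *)
  congr Some; apply: sepH => v vk; apply: (mulfI e0).
  have vk1 : (size v <= k.+1)%N by apply: leqW.
  rewrite -(fE r v vk1) -(cond_word_prob_succ v sx) -(f_emit s).
  by rewrite -(cond_word_prob_succ v fsx) fE.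
exists f; split; [by exists g| |by []].
(* The pullback of the stationary vector of [H] along [f] is stationary for [G]. *)
apply: stat_unique; have [st0 st1 stT] := stat_stationary H.
have f_bij : bijective f by exists g.
split=> [s||t]; first exact: st0.
  by rewrite -st1 [RHS](reindex f) //; apply: onW_bij.
rewrite -stT [RHS](reindex f); last exact: onW_bij.
apply: eq_bigr => s _; congr (_ * _).
rewrite !transitionE; apply: eq_bigr => x _; rewrite /step f_emit f_succ.
by case: (succ s x) => [u|] //=; rewrite !(inj_eq Some_inj) (can_eq fK).
Qed.

End Matching.

(** * From extended-real radii to natural-number bounds *)

Section Radii.
Local Open Scope classical_set_scope.
Context {R : realType}.

Lemma size_ereal_inf_lt (X : Type) (A : set (seq X)) (k : nat) :
  (ereal_inf [set ((size w)%:R : R)%:E | w in A] < (k.+1%:R)%:E)%E ->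
  exists2 w, A w & (size w <= k)%N.
Proof.
by move=> /ereal_inf_lt[_ [w Aw <-]]; rewrite lte_fin ltr_nat ltnS; exists w.
Qed.

Lemma bigmaxe_ge0 (I : finType) (P : pred I) (F : I -> \bar R) :
  (0 <= \big[maxe/0]_(i | P i) F i)%E.
Proof. by elim/big_rec: _ => // i x _ x0; rewrite le_max x0 orbT. Qed.

(** Rounding down avoids proving that the radii are integers: the lower bound enters the length
    count, and the strict upper bound yields words of length at most [k]. *)
Lemma ereal_floor (x : \bar R) : (0 <= x)%E -> x \is a fin_num ->
  exists2 k : nat, ((k%:R)%:E <= x)%E & (x < (k.+1%:R)%:E)%E.
Proof.
case: x => [r| |] // r0 _; exists (Num.truncn r);
  by have /andP[] := truncn_itv r0.
Qed.

Context {X : finType} {G : generator R X}.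

Lemma L_tar_sync_bound (a : nat) : (L_tar G < (a.+1%:R)%:E)%E -> sync_bound G a.
Proof.
move=> Ga s; have [w] := @size_ereal_inf_lt _ [set w | synchronizes w s] a
  (le_lt_trans (le_bigmax _ _ s) Ga).
by exists w.
Qed.

Lemma L_sep_sep_bound (k : nat) : (L_sep G < (k.+1%:R)%:E)%E -> sep_bound G k.
Proof.
move=> Gk s t st; apply/eqP/negPn/negP => neq.
have [v /= vst vk] := @size_ereal_inf_lt _
  [set v | cond_word_prob s v <> cond_word_prob t v] k
  (le_lt_trans (@le_bigmax_cond _ _ _ _ (s, t) (fun p => p.1 != p.2) _ neq) Gk).
exact/vst/st.
Qed.

End Radii.

Theorem corollary5p3 (R : realType) (X : finType) (hX : (0 < #|X|)%N)
  (GP GQ : generator R X)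
  (dP : measure_display) (OmegaP : measurableType dP)
  (P : probability OmegaP R)
  (SP : int -> OmegaP -> GP) (XP : int -> OmegaP -> X)
  (hP : generates P SP XP)
  (dQ : measure_display) (OmegaQ : measurableType dQ)
  (Q : probability OmegaQ R)
  (SQ : int -> OmegaQ -> GQ) (XQ : int -> OmegaQ -> X)
  (hQ : generates Q SQ XQ)
  (exactP : exact GP) (exactQ : exact GQ)
  (n : nat)
  (hn : (L_tar GP + L_tar GQ + maxe (L_sep GP) (L_sep GQ) + 1 <= n%:R%:E)%E)
  (hPQ : forall w : n.-tuple X, block_law P XP w = block_law Q XQ w) :
  isomorphic GP GQ.
Proof.
have obsE w : size w = n -> obs_prob GP w = obs_prob GQ w.
  move=> /eqP wn; have := hPQ (Tuple wn).
  by rewrite (block_lawE hP) (block_lawE hQ) => -[].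
have obs_leE := obs_prob_shorter obsE.
have a0 : (0 <= L_tar GP)%E := bigmaxe_ge0 _ _.
have b0 : (0 <= L_tar GQ)%E := bigmaxe_ge0 _ _.
have d0 : (0 <= maxe (L_sep GP) (L_sep GQ))%E by rewrite le_max bigmaxe_ge0.
(* The sum lies between 0 and [n], so each radius is finite. *)
have fin : (L_tar GP + L_tar GQ + maxe (L_sep GP) (L_sep GQ) + 1)%E
    \is a fin_num.
  by rewrite fin_numElt (le_lt_trans hn) ?ltry // andbT
    (lt_le_trans (ltNyr 0)) // !adde_ge0.
move: fin; rewrite !fin_numD => /andP[/andP[/andP[afin bfin] dfin] _].
have [a a_le a_gt] := ereal_floor a0 afin.
have [b b_le b_gt] := ereal_floor b0 bfin.
have [k k_le k_gt] := ereal_floor d0 dfin.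
have abkn : (a + b + k.+1 <= n)%N.
  rewrite -(ler_nat R) -lee_fin (le_trans _ hn) //.
  by rewrite addnS -addn1 !natrD !EFinD !leeD.
move: k_gt; rewrite gt_max => /andP[kP kQ].
apply: (agree_isomorphic (k := k)).
- exact: L_sep_sep_bound.
- exact: L_sep_sep_bound.
- apply: (agree_exists (a := a) (b := b)).
  + exact: L_tar_sync_bound.
  + exact: L_tar_sync_bound.
  + by move=> w wn; apply: obs_leE; apply: leq_trans abkn.
(* The same argument with the two generators exchanged. *)
- apply: (agree_exists (a := b) (b := a)).
  + exact: L_tar_sync_bound.
  + exact: L_tar_sync_bound.
  + by move=> w wn; apply/esym/obs_leE; apply: leq_trans abkn; rewrite (addnC a).
Qed.
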